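(* Let $L$ be a loop and let $(L_i)_{i\geq 1}$ be its commutator-associator filtration. Then: (1) each $L_i$ is a normal subloop of $L$ that is preserved by all automorphisms of $L$; (2) for every $i\ge 1$ the quotient $L_i/L_{i+1}$ is an abelian group; (3) the commutator, the associator and all the deviations in $L$ induce well-defined multilinear operations, respecting the grading, on the associated graded abelian group $\bigoplus_{i\geq 1} L_i/L_{i+1}$. That is, for all $p,q,r\ge 1$ the commutator $(a,b)\mapsto[a,b]$ induces a well-defined biadditive map $L_p/L_{p+1}\times L_q/L_{q+1}\to L_{p+q}/L_{p+q+1}$; the associator $(a,b,c)\mapsto (a,b,c)$ induces a well-defined triadditive map $L_p/L_{p+1}\times L_q/L_{q+1}\times L_r/L_{r+1}\to L_{p+q+r}/L_{p+q+r+1}$; and for every $n\geq 1$, every admissible sequence $\alpha_1,\ldots,\alpha_n$ and all $p_1,\ldots,p_{n+3}\geq 1$, the deviation $(a_1,\ldots,a_{n+3})\mapsto(a_1,\ldots,a_{n+3})_{\alpha_1,\ldots,\alpha_n}$ induces a well-defined map $\prod_{j=1}^{n+3}L_{p_j}/L_{p_j+1}\to L_{p}/L_{p+1}$ with $p=p_1+\ldots+p_{n+3}$, additive in each argument.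
   Context: A loop is a set $L$ with a binary operation (written as juxtaposition) having a two-sided identity $1$ and such that for all $a,b\in L$ the equations $ax=b$ and $ya=b$ have unique solutions, denoted $x=a\backslash b$ and $y=b/a$. A subloop is normal if it is the kernel of a loop homomorphism; the subloop of $L$ normally generated by a subset is the smallest normal subloop of $L$ containing it. The commutator of $a,b\in L$ is $[a,b]:=(ba)\backslash(ab)$. The associator of $a,b,c\in L$ is $(a,b,c):=(a(bc))\backslash((ab)c)$. For a positive integer $n$, a sequence of integers $\alpha_1,\ldots,\alpha_n$ (not necessarily distinct) is admissible if $1\leq\alpha_k\leq k+2$ for all $k$. For each admissible sequence the deviation (of level $n$) is the function $L^{n+3}\to L$ defined inductively by $$(a_1,\ldots,a_{n+3})_{\alpha_1,\ldots,\alpha_n}:=\bigl(A(a_{\alpha_n})A(a_{\alpha_n+1})\bigr)\backslash A(a_{\alpha_n}a_{\alpha_n+1}),$$ where $A(x):=(a_1,\ldots,a_{\alpha_n-1},x,a_{\alpha_n+2},\ldots,a_{n+3})_{\alpha_1,\ldots,\alpha_{n-1}}$; for $n=1$ the right-hand side of the definition of $A$ is the associator (the deviation of level $0$). The commutator-associator filtration $(L_i)_{i\ge1}$ of $L$ is defined recursively: $L_1=L$, and for $i\geq 2$, $L_i$ is the subloop of $L$ normally generated by (a) all $[a,b]$ with $a\in L_p$, $b\in L_q$ and $p+q\geq i$; (b) all $(a,b,c)$ with $a\in L_p$, $b\in L_q$, $c\in L_r$ and $p+q+r\geq i$; (c) all $(a_1,\ldots,a_{n+3})_{\alpha_1,\ldots,\alpha_n}$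 with $n\geq1$, $\alpha_1,\ldots,\alpha_n$ admissible, $a_j\in L_{p_j}$ and $p_1+\ldots+p_{n+3}\geq i$. Here all indices $p,q,r,p_j$ range over $\{1,\ldots,i-1\}$. *)

(* Defs.v *)
From HB Require Import structures.
From mathcomp Require Import all_boot.
From mathcomp Require Import boolp classical_sets.

Set Implicit Arguments.
Unset Strict Implicit.
Unset Printing Implicit Defensive.

Local Open Scope classical_set_scope.
Local Open Scope group_scope.

(* [ldiv a b] is a \ b, the unique x such that a x = b;
   [rdiv b a] is b / a, the unique y such that y a = b. *)
HB.mixin Record BaseUMagma_isLoop L of BaseUMagma L := {
  loop_mul1g : left_id 1 (@mul L);
  loop_mulg1 : right_id 1 (@mul L);
  ldiv : L -> L -> L;
  rdiv : L -> L -> L;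
  ldivP : forall a b x : L, a * x = b <-> x = ldiv a b;
  rdivP : forall a b y : L, y * a = b <-> y = rdiv b a
}.

#[short(type="loopType")]
HB.structure Definition Loop := {L of BaseUMagma_isLoop L & BaseUMagma L}.

Bind Scope group_scope with Loop.sort.

(* An associative loop is a group, the inverse of x being [ldiv x 1]. *)
Definition abelian_group (M : loopType) : Prop :=
  associative (@mul M) /\ commutative (@mul M).

Section LoopTheory.
Variable L : loopType.
Implicit Types (H N : set L) (a b c : L).

Lemma mulKl a b : ldiv a (a * b) = b.
Proof. by symmetry; apply/ldivP. Qed.

Lemma mulVKl a b : a * ldiv a b = b.
Proof. by apply/ldivP. Qed.

Lemma mulKr a b : rdiv (b * a) a = b.
Proof. by symmetry; apply/rdivP. Qed.

Lemma mulVKr a b : rdiv b a * a = b.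
Proof. by apply/rdivP. Qed.

Lemma ldivgg a : ldiv a a = 1.
Proof. by symmetry; apply/ldivP; rewrite loop_mulg1. Qed.

Lemma rdivgg a : rdiv a a = 1.
Proof. by symmetry; apply/rdivP; rewrite loop_mul1g. Qed.

Definition subloop H : Prop :=
  [/\ H 1, forall a b, H a -> H b -> H (a * b),
      forall a b, H a -> H b -> H (ldiv a b) &
      forall a b, H a -> H b -> H (rdiv a b)].

(* Multiplicative maps between loops automatically preserve 1, \ and /. *)
Definition normal_subloop N : Prop :=
  exists (M : loopType) (f : {multiplicative L -> M}), N = [set x | f x = 1].

Definition loop_commutator a b : L := ldiv (b * a) (a * b).

Definition loop_associator a b c : L := ldiv (a * (b * c)) ((a * b) * c).

Definition coset N a : set L := [set a * x | x in N].

End LoopTheory.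

Section MorphTheory.
Variables (L M : loopType) (f : {multiplicative L -> M}).

Lemma loop_morphM a b : f (a * b) = f a * f b.
Proof. exact: gmulfM. Qed.

Lemma loop_morph_ldiv a b : f (ldiv a b) = ldiv (f a) (f b).
Proof. by apply/ldivP; rewrite -loop_morphM mulVKl. Qed.

Lemma loop_morph_rdiv a b : f (rdiv a b) = rdiv (f a) (f b).
Proof. by apply/rdivP; rewrite -loop_morphM mulVKr. Qed.

Lemma loop_morph1 : f 1 = 1.
Proof. by rewrite -(ldivgg 1) loop_morph_ldiv ldivgg. Qed.

Lemma coset_kerE a : coset [set x | f x = 1] a = [set x | f x = f a].
Proof.
apply/seteqP; split=> x /= => [[y /= fy <-]|fx].
  by rewrite loop_morphM fy loop_mulg1.
exists (ldiv a x) => /=; last exact: mulVKl.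
by rewrite loop_morph_ldiv fx ldivgg.
Qed.

End MorphTheory.

Section Quotient.
Variable L : loopType.
Implicit Types (H N : set L) (a b : L).

Lemma normal_subloopW N : normal_subloop N -> subloop N.
Proof.
move=> [M [f ->]]; split=> /= [|a b fa fb|a b fa fb|a b fa fb].
- exact: loop_morph1.
- by rewrite loop_morphM fa fb loop_mulg1.
- by rewrite loop_morph_ldiv fa fb ldivgg.
- by rewrite loop_morph_rdiv fa fb rdivgg.
Qed.

Lemma coset_mul N a b : normal_subloop N ->
  [set x * y | x in coset N a & y in coset N b] = coset N (a * b).
Proof.
move=> [M [f ->]]; rewrite !coset_kerE.
apply/seteqP; split=> x /= => [[y /= fy [z /= fz <-]]|fx].
  by rewrite !loop_morphM fy fz.
exists a => //; exists (ldiv a x); last exact: mulVKl.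
by rewrite /= loop_morph_ldiv fx loop_morphM mulKl.
Qed.

Lemma coset_ldiv N a b : normal_subloop N ->
  [set ldiv x y | x in coset N a & y in coset N b] = coset N (ldiv a b).
Proof.
move=> [M [f ->]]; rewrite !coset_kerE.
apply/seteqP; split=> x /= => [[y /= fy [z /= fz <-]]|fx].
  by rewrite !loop_morph_ldiv fy fz.
exists a => //; exists (a * x); last exact: mulKl.
by rewrite /= loop_morphM fx loop_morph_ldiv mulVKl.
Qed.

Lemma coset_rdiv N a b : normal_subloop N ->
  [set rdiv x y | x in coset N a & y in coset N b] = coset N (rdiv a b).
Proof.
move=> [M [f ->]]; rewrite !coset_kerE.
apply/seteqP; split=> x /= => [[y /= fy [z /= fz <-]]|fx].
  by rewrite !loop_morph_rdiv fy fz.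
exists (x * b); first by rewrite /= loop_morphM fx loop_morph_rdiv mulVKr.
by exists b => //; exact: mulKr.
Qed.

Variables (H N : set L) (hH : subloop H) (nN : normal_subloop N).

(* The quotient loop H / N: the cosets aN with a in H, under elementwise
   operations. Only used when N is contained in H. *)
Definition quot of subloop H & normal_subloop N : Type :=
  {C : set L | exists2 a, H a & C = coset N a}.
Local Notation Q := (quot hH nN).

Lemma quot_eq (u v : Q) : sval u = sval v -> u = v.
Proof.
case: u v => [C hC] [D hD] /= CD; rewrite -CD in hD *.
by rewrite (Prop_irrelevance hC hD).
Qed.

Definition quot_class a (ha : H a) : Q :=
  exist _ (coset N a) (ex_intro2 _ _ a ha erefl).

Fact quot_mul_subproof (u v : Q) : exists2 a, H a &
  [set x * y | x in sval u & y in sval v] = coset N a.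
Proof.
have [[a ha ->] [b hb ->]] := (svalP u, svalP v); exists (a * b).
  by case: hH => _ + _ _; apply.
exact: coset_mul.
Qed.
Definition quot_mul (u v : Q) : Q := exist _ _ (quot_mul_subproof u v).

Fact quot_ldiv_subproof (u v : Q) : exists2 a, H a &
  [set ldiv x y | x in sval u & y in sval v] = coset N a.
Proof.
have [[a ha ->] [b hb ->]] := (svalP u, svalP v); exists (ldiv a b).
  by case: hH => _ _ + _; apply.
exact: coset_ldiv.
Qed.
Definition quot_ldiv (u v : Q) : Q := exist _ _ (quot_ldiv_subproof u v).

Fact quot_rdiv_subproof (u v : Q) : exists2 a, H a &
  [set rdiv x y | x in sval u & y in sval v] = coset N a.
Proof.
have [[a ha ->] [b hb ->]] := (svalP u, svalP v); exists (rdiv a b).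
  by case: hH => _ _ _; apply.
exact: coset_rdiv.
Qed.
Definition quot_rdiv (u v : Q) : Q := exist _ _ (quot_rdiv_subproof u v).

Fact quot_one_subproof : H 1. Proof. by case: hH. Qed.
Definition quot_one : Q := quot_class quot_one_subproof.

HB.instance Definition _ := hasMul.Build Q quot_mul.
HB.instance Definition _ := hasOne.Build Q quot_one.

Fact quot_mul1g : left_id quot_one quot_mul.
Proof.
move=> u; apply: quot_eq => /=; have [a ha ->] := svalP u.
by rewrite coset_mul ?loop_mul1g.
Qed.

Fact quot_mulg1 : right_id quot_one quot_mul.
Proof.
move=> u; apply: quot_eq => /=; have [a ha ->] := svalP u.
by rewrite coset_mul ?loop_mulg1.
Qed.

Fact quot_ldivP (u v w : Q) : quot_mul u w = v <-> w = quot_ldiv u v.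
Proof.
split=> [<-|->]; apply: quot_eq => /=.
  have [[a ha ->] [b hb ->]] := (svalP u, svalP w).
  by rewrite coset_mul ?coset_ldiv ?mulKl.
have [[a ha ->] [b hb ->]] := (svalP u, svalP v).
by rewrite coset_ldiv ?coset_mul ?mulVKl.
Qed.

Fact quot_rdivP (u v w : Q) : quot_mul w u = v <-> w = quot_rdiv v u.
Proof.
split=> [<-|->]; apply: quot_eq => /=.
  have [[a ha ->] [b hb ->]] := (svalP u, svalP w).
  by rewrite coset_mul ?coset_rdiv ?mulKr.
have [[a ha ->] [b hb ->]] := (svalP u, svalP v).
by rewrite coset_rdiv ?coset_mul ?mulVKr.
Qed.

HB.instance Definition _ := BaseUMagma_isLoop.Build Q
  quot_mul1g quot_mulg1 quot_ldivP quot_rdivP.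

End Quotient.

(* Admissible sequences of length n, with indices and values shifted to start
   at 0: alpha k is alpha_(k+1) - 1, so that the condition
   1 <= alpha_(k+1) <= k + 3 becomes alpha k < k + 3. *)
Definition admissible (n : nat) : Type := forall k : 'I_n, 'I_k.+3.

Definition admissible_belast n (alpha : admissible n.+1) : admissible n :=
  fun k => alpha (widen_ord (leqnSn n) k).

(* The tuple (a_0, ..., a_(i-1), x, a_(i+2), ..., a_m). *)
Definition merge_at (T : Type) (m : nat) (a : 'I_m.+1 -> T) (i : 'I_m) (x : T) :
    'I_m -> T :=
  fun k => if k == i then x else a (lift (lift ord0 i) k).

Lemma merge_atE (T : Type) m (a : nat -> T) (i : 'I_m) x (k : 'I_m) :
  merge_at (fun j : 'I_m.+1 => a j) i x k =
  if k < i then a k else if k == i :> nat then x else a k.+1.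
Proof.
rewrite /merge_at /= /bump /= -val_eqE /=.
by rewrite /bump /= add1n; case: (ltngtP k i) => // ki; rewrite add0n.
Qed.

(* The deviation of level n; level 0 is the associator. *)
Fixpoint deviation (L : loopType) (n : nat) :
    admissible n -> ('I_n.+3 -> L) -> L :=
  if n is m.+1 then fun alpha a =>
    let i : 'I_m.+3 := alpha ord_max in
    let A x := deviation (admissible_belast alpha) (merge_at a i x) in
    let u := a (widen_ord (leqnSn _) i) in
    let v := a (lift ord0 i) in
    ldiv (A u * A v) (A (u * v))
  else fun _ a =>
    loop_associator (a (inord 0)) (a (inord 1)) (a (inord 2)).

Section Filtration.
Variable L : loopType.

(* The generators of the i-th term, F giving the previous terms. *)
Inductive ca_gens (F : nat -> set L) (i : nat) : set L :=
| CaCommutator p q a b of 0 < p < i & 0 < q < i & i <= p + q &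
    F p a & F q b :
    ca_gens F i (loop_commutator a b)
| CaAssociator p q r a b c of 0 < p < i & 0 < q < i & 0 < r < i &
    i <= p + q + r & F p a & F q b & F r c :
    ca_gens F i (loop_associator a b c)
| CaDeviation n (alpha : admissible n) (p : 'I_n.+3 -> nat) (a : 'I_n.+3 -> L)
    of 0 < n & (forall j, 0 < p j < i) & i <= \sum_(j < n.+3) p j &
    (forall j, F (p j) (a j)) :
    ca_gens F i (deviation alpha a).

(* [ca_upto m i] is the i-th term of the filtration for i <= m + 1. *)
Fixpoint ca_upto (m : nat) : nat -> set L :=
  if m is k.+1 then fun i =>
    if i <= k.+1 then ca_upto k i
    else smallest (@normal_subloop L) (ca_gens (ca_upto k) i)
  else fun=> setT.

(* The term of index 0, which plays no role, is L. *)
Definition ca_filtration (i : nat) : set L := ca_upto i.-1 i.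

Lemma ca_filtration1 : ca_filtration 1 = setT.
Proof. by []. Qed.

Lemma ca_uptoE m i : i <= m.+1 -> ca_upto m i = ca_filtration i.
Proof.
elim: m i => [|m IH] i; first by case: i => [|[]].
move=> im /=; case: ifPn => [/IH //|]; rewrite -ltnNge => mi.
have {im mi}-> : i = m.+2 by apply/eqP; rewrite eqn_leq im.
by rewrite /ca_filtration /= ltnn.
Qed.

Lemma ca_gens_sub (F G : nat -> set L) i :
  (forall p, 0 < p < i -> F p `<=` G p) -> ca_gens F i `<=` ca_gens G i.
Proof.
move=> FG _ [].
- move=> p q a b hp hq hi ha hb.
  by apply: (CaCommutator hp hq hi); apply: FG.
- move=> p q r a b c hp hq hr hi ha hb hc.
  by apply: (CaAssociator hp hq hr hi); apply: FG.
- move=> n alpha p a hn hp hi ha.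
  by apply: (CaDeviation _ hn hp hi) => j; apply: FG.
Qed.

Lemma ca_filtrationE i : 1 < i ->
  ca_filtration i = smallest (@normal_subloop L) (ca_gens ca_filtration i).
Proof.
case: i => [|[|i]] // _; rewrite {1}/ca_filtration /= ltnn.
congr smallest; apply/seteqP; split; apply: ca_gens_sub => p /andP[_ pi];
  by rewrite ca_uptoE.
Qed.

End Filtration.

Arguments ca_filtration : clear implicits.

Section Graded.
Variables (L : loopType) (nL : forall i, normal_subloop (ca_filtration L i)).

(* The quotient L_i / L_(i+1), and the class in it of an element of L_i. *)
Definition ca_gr (i : nat) : loopType :=
  quot (normal_subloopW (nL i)) (nL i.+1).

Definition ca_class (i : nat) (a : L) (ha : ca_filtration L i a) : ca_gr i :=
  quot_class (normal_subloopW (nL i)) (nL i.+1) ha.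

End Graded.

(* Main.v *)
Require Import Defs.
From HB Require Import structures.
From mathcomp Require Import all_boot.
From mathcomp Require Import boolp classical_sets.

Set Implicit Arguments.
Unset Strict Implicit.
Unset Printing Implicit Defensive.

Local Open Scope classical_set_scope.
Local Open Scope group_scope.

(** Each term of the filtration is generated by operations whose degrees add up
    to its index, so an operation applied to arguments of positive degrees
    [p_1, ..., p_m] lands in the term of index [p_1 + ... + p_m]
    ([ca_commutator_in], [ca_associator_in], [ca_deviation_in]).  The terms
    decrease ([ca_filtrationS]), so raising the total degree of an expression
    makes it vanish in the graded quotient.

    Commutators of [L_i] lie in [L_(2i)] and associators in [L_(3i)], both
    inside [L_(i+1)]; hence [L_i / L_(i+1)] is an abelian group.

    A deviation of level [n + 1] is by definition the failure of additivity, in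
    one argument, of a deviation of level [n].  Splitting an argument of degree
    [p_j] into two factors of that degree makes the total degree
    [p + p_j > p], so the failure vanishes modulo [L_(p+1)]
    ([deviation_multiadditive]); the associator is the case of level 0.  For the
    commutator, whose additivity defect is not among the generators, the
    expansion of [[a b, c]] only involves associators of total degree above
    [p + q] and commutators that are central modulo [L_(p+q+1)]
    ([ca_commutatorDl], [ca_commutatorDr]).

    Additivity gives independence of representatives: if [u' = u z] with [z] one
    degree deeper, then the operation at [u'] is its value at [u] times its
    value at [z], which lies one term deeper ([multiadditive_congr],
    [ca_commutator_congr]).

    Kernels are closed under intersection, so a normally generated subloop is
    itself a kernel ([normal_smallest]), and the preimage of a kernel under an
    endomorphism is a kernel, so every endomorphism maps each term into itself
    ([ca_filtration_morph]). *)

(** * Normal subloops and congruences *)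

Section LoopProduct.
Variables (I : Type) (Q : I -> loopType).

Definition loop_prod : Type := forall i, Q i.
Implicit Types u v w : loop_prod.

HB.instance Definition _ :=
  hasMul.Build loop_prod (fun u v i => u i * v i).
HB.instance Definition _ := hasOne.Build loop_prod (fun=> 1).

Fact loop_prod_mul1g : left_id 1 (@mul loop_prod).
Proof.
by move=> u; apply: functional_extensionality_dep => i; exact: loop_mul1g.
Qed.

Fact loop_prod_mulg1 : right_id 1 (@mul loop_prod).
Proof.
by move=> u; apply: functional_extensionality_dep => i; exact: loop_mulg1.
Qed.

Fact loop_prod_ldivP u v w : u * w = v <-> w = (fun i => ldiv (u i) (v i)).
Proof.
split=> [<-|->]; apply: functional_extensionality_dep => i.
  by rewrite mulKl.
exact: mulVKl.
Qed.

Fact loop_prod_rdivP u v w : w * u = v <-> w = (fun i => rdiv (v i) (u i)).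
Proof.
split=> [<-|->]; apply: functional_extensionality_dep => i.
  by rewrite mulKr.
exact: mulVKr.
Qed.

HB.instance Definition _ := BaseUMagma_isLoop.Build loop_prod
  loop_prod_mul1g loop_prod_mulg1 loop_prod_ldivP loop_prod_rdivP.

End LoopProduct.

Section NormalSubloops.
Variable L : loopType.
Implicit Types (N : set L) (a b c : L).

(** For a kernel, cosets are the fibres of the homomorphism, so they compare by
    a single left division. *)
Lemma coset_eqP N a b : normal_subloop N ->
  coset N a = coset N b <-> N (ldiv a b).
Proof.
move=> [M [f ->]]; rewrite !coset_kerE /= loop_morph_ldiv; split=> [E|fab].
  have /= <- : [set x | f x = f b] a by rewrite -E.
  exact: ldivgg.
have -> : f a = f b; last by [].
by rewrite -(mulVKl (f a) (f b)) fab loop_mulg1.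
Qed.

Lemma coset_eq1 N a : normal_subloop N -> coset N a = coset N 1 <-> N a.
Proof.
move=> nN; have [N1 _ Nl Nr] := normal_subloopW nN.
rewrite (coset_eqP _ _ nN); split=> Na; last exact: Nl.
by rewrite -(mulKr (ldiv a 1) a) mulVKl; apply: Nr.
Qed.

Lemma coset_absorb N a z : normal_subloop N -> N z ->
  coset N (a * z) = coset N a.
Proof.
by move=> nN Nz; rewrite -coset_mul // ((coset_eq1 _ nN).2 Nz) coset_mul //
  loop_mulg1.
Qed.

(** The intersection is the kernel of the diagonal map to the product of all the
    quotients [L / N]. *)
Lemma normal_bigcap (D : set (set L)) :
  (forall N, D N -> normal_subloop N) ->
  normal_subloop (\bigcap_(N in D) N).
Proof.
move=> nD.
have sT : subloop [set: L] by [].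
pose Q (u : {N | D N}) : loopType := quot sT (nD _ (svalP u)).
pose f a : loop_prod Q := fun u => quot_class sT (nD _ (svalP u)) (I : setT a).
have fM : {morph f : a b / a * b}.
  move=> a b; apply: functional_extensionality_dep => u.
  by apply: quot_eq => /=; rewrite coset_mul //; exact: (nD _ (svalP u)).
exists (loop_prod Q), (HB.pack_for {multiplicative L -> loop_prod Q} f
  (isMultiplicative.Build _ _ f fM)).
apply/seteqP; split=> a /= => [Da|fa N DN].
  apply: functional_extensionality_dep => u; apply: quot_eq => /=.
  by apply/(coset_eq1 _ (nD _ (svalP u))); exact: Da (svalP u).
apply/(coset_eq1 _ (nD N DN)).
by have := f_equal (fun g : loop_prod Q => sval (g (exist _ N DN))) fa.
Qed.

Lemma normal_smallest (G : set L) :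
  normal_subloop (smallest (@normal_subloop L) G).
Proof. by apply: normal_bigcap => N []. Qed.

Lemma normal_setT : normal_subloop [set: L].
Proof.
have <- : smallest (@normal_subloop L) setT = setT.
  by apply/seteqP; split=> // x _ N [_]; apply.
exact: normal_smallest.
Qed.

Lemma normal_preimage (M : loopType) (f : {multiplicative L -> M}) (N : set M) :
  normal_subloop N -> normal_subloop (f @^-1` N).
Proof.
move=> [K [g ->]].
have gfM : {morph g \o f : a b / a * b}.
  by move=> a b /=; rewrite !loop_morphM.
exists K, (HB.pack_for {multiplicative L -> K} (g \o f)
  (isMultiplicative.Build _ _ (g \o f) gfM)).
by [].
Qed.

End NormalSubloops.

(** * Tuples and degrees *)

Definition replace_at (T : Type) m (a : 'I_m -> T) (j : 'I_m) (x : T) :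
    'I_m -> T :=
  fun k => if k == j then x else a k.

Lemma replace_at_id (T : Type) m (a : 'I_m -> T) j : replace_at a j (a j) = a.
Proof. by apply/funext => k; rewrite /replace_at; case: eqP => [->|]. Qed.

Lemma replace_at_all (T : Type) (P : nat -> T -> Prop) m p (a : 'I_m -> T)
    j s x :
  (forall k, P (p k) (a k)) -> P s x ->
  forall k, P (replace_at p j s k) (replace_at a j x k).
Proof. by move=> Pa Px k; rewrite /replace_at; case: eqP. Qed.

Lemma replace_at_all_in (T : Type) (P : nat -> T -> Prop) m p (a : 'I_m -> T)
    j x :
  (forall k, P (p k) (a k)) -> P (p j) x ->
  forall k, P (p k) (replace_at a j x k).
Proof. by move=> Pa Px k; rewrite /replace_at; case: eqP => // ->. Qed.

Lemma sum_replace_atS m (p : 'I_m -> nat) j :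
  (\sum_(k < m) replace_at p j (p j).+1 k = (\sum_(k < m) p k).+1)%N.
Proof.
rewrite (bigD1 j) //= [in RHS](bigD1 j) //= /replace_at eqxx -addSn.
by congr (_ + _)%N; apply: eq_bigr => k /negPf ->.
Qed.

Lemma ltn_sum_pos m (p : 'I_m -> nat) j :
  (1 < m)%N -> (forall k, 0 < p k)%N -> (p j < \sum_(k < m) p k)%N.
Proof.
case: m p j => [|[|m]] // p j _ p0.
rewrite (bigD1_ord j) //= -addn1 leq_add2l (bigD1 ord0) //=.
exact: leq_trans (p0 _) (leq_addr _ _).
Qed.

(** * The filtration *)

Section Filtration.
Variable L : loopType.
Local Notation F := (ca_filtration L).

Lemma ca_filtration_normal i : normal_subloop (F i).
Proof.
case: i => [|[|i]]; try exact: normal_setT.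
by rewrite ca_filtrationE //; exact: normal_smallest.
Qed.
Local Notation nF := (ca_filtration_normal _).

Lemma ca_filtration_gens i : (1 < i)%N -> ca_gens F i `<=` F i.
Proof.
by move=> i1; rewrite [X in _ `<=` X]ca_filtrationE.
Qed.

(** For [i > 1], a generator of [L_(i+1)] is a generator of [L_i] once its
    degrees are lowered to at most [i - 1].  The arguments still belong to the
    lowered terms by induction, and the total stays at least [i]: if some degree
    was lowered, it contributes [i - 1] and any other argument at least 1. *)
Lemma ca_filtrationS i : F i.+1 `<=` F i.
Proof.
elim: i => [|[|i] IH]; try by [].
rewrite ca_filtrationE //; apply: smallest_sub nF _.
(* The two base cases used up two indices: the terms compared are of index
   [i.+3] and [i.+2], and degrees are lowered to at most [i.+1]. *)
pose t p := minn p i.+1.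
have Ft p x : (p < i.+3)%N -> F p x -> F (t p) x.
  rewrite ltnS leq_eqVlt => /orP[/eqP-> /IH|]; rewrite /t.
    by rewrite (minn_idPr _).
  by rewrite ltnS => /minn_idPl ->.
have t_bd p : (0 < p)%N -> (0 < t p < i.+2)%N.
  by move=> p0; rewrite /t leq_min p0 /= ltnS geq_minr.
have t_sum m (p : 'I_m -> nat) : (1 < m)%N -> (forall j, 0 < p j)%N ->
    (i.+2 < \sum_(j < m) p j)%N -> (i.+1 < \sum_(j < m) t (p j))%N.
  move=> m1 p0 le_p.
  have t0 j : (0 < t (p j))%N by case/andP: (t_bd _ (p0 j)).
  case: (pselect (exists j, (i.+1 <= p j)%N)) => [[j le_j]|small].
    by have := ltn_sum_pos j m1 t0; rewrite {1}/t (minn_idPr le_j).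
  rewrite (eq_bigr p) ?(ltnW le_p) // => j _; apply/minn_idPl.
  by rewrite leqNgt; apply/negP => /ltnW le_j; apply: small; exists j.
move=> _ [p q a b /andP[p0 pi] /andP[q0 qi] le_i Fa Fb
         |p q r a b c /andP[p0 pi] /andP[q0 qi] /andP[r0 ri] le_i Fa Fb Fc
         |n alpha p a n0 p_bd le_i Fa]; apply: ca_filtration_gens => //.
- apply: (@CaCommutator _ _ _ (t p) (t q)); rewrite ?t_bd //; try exact: Ft.
  have := t_sum _ (tnth [tuple p; q]) isT.
  rewrite !big_ord_recl !big_ord0 /= !addn0; apply=> //.
  by case=> [[|[|]]].
- apply: (@CaAssociator _ _ _ (t p) (t q) (t r)); rewrite ?t_bd //;
    try exact: Ft.
  have := t_sum _ (tnth [tuple p; q; r]) isT.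
  rewrite !big_ord_recl !big_ord0 /= !addn0 !addnA; apply=> //.
  by case=> [[|[|[|]]]].
- apply: (@CaDeviation _ _ _ _ _ (t \o p)) => //.
  + by move=> j; apply: t_bd; case/andP: (p_bd j).
  + by apply: t_sum => // j; case/andP: (p_bd j).
  + by move=> j; apply: Ft => //; case/andP: (p_bd j).
Qed.

Lemma ca_filtration_anti i j : (i <= j)%N -> F j `<=` F i.
Proof.
elim: j => [|j IH]; first by rewrite leqn0 => /eqP->.
rewrite leq_eqVlt => /orP[/eqP-> //|]; rewrite ltnS => /IH ij.
by move=> x /ca_filtrationS; exact: ij.
Qed.

Lemma ca_commutator_in p q a b : (0 < p)%N -> (0 < q)%N ->
  F p a -> F q b -> F (p + q) (loop_commutator a b).
Proof.
move=> p0 q0 Fa Fb.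
apply: ca_filtration_gens; first by rewrite (leq_add p0 q0).
apply: (CaCommutator _ _ _ Fa Fb); rewrite // ?p0 ?q0 /=.
  by rewrite -addn1 leq_add2l.
by rewrite -add1n leq_add2r.
Qed.

Lemma ca_associator_in p q r a b c : (0 < p)%N -> (0 < q)%N -> (0 < r)%N ->
  F p a -> F q b -> F r c -> F (p + q + r) (loop_associator a b c).
Proof.
move=> p0 q0 r0 Fa Fb Fc.
apply: ca_filtration_gens.
  by apply: leq_trans (leq_addr _ _); rewrite (leq_add p0 q0).
apply: (CaAssociator _ _ _ _ Fa Fb Fc); rewrite // ?p0 ?q0 ?r0 /=.
- by rewrite -addnA -{1}[p]addn0 ltn_add2l addn_gt0 q0.
- by rewrite addnAC -{1}[q]add0n ltn_add2r addn_gt0 p0.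
- by rewrite -{1}[r]add0n ltn_add2r addn_gt0 p0.
Qed.

Lemma ca_deviation_in n (alpha : admissible n) p (a : 'I_n.+3 -> L) :
  (forall j, 0 < p j)%N -> (forall j, F (p j) (a j)) ->
  F (\sum_(j < n.+3) p j)%N (deviation alpha a).
Proof.
move=> p0 Fa; case: n => [|n] in alpha p p0 a Fa *.
  rewrite /= !big_ord_recl big_ord0 addn0 addnA.
  apply: ca_associator_in; rewrite ?p0 //.
  - by have -> : ord0 = inord 0 :> 'I_3 by apply: val_inj; rewrite /= inordK.
  - by have -> : lift ord0 ord0 = inord 1 :> 'I_3
      by apply: val_inj; rewrite /= inordK.
  - by have -> : lift ord0 (lift ord0 ord0) = inord 2 :> 'I_3
      by apply: val_inj; rewrite /= inordK.
apply: ca_filtration_gens.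
  by apply: leq_ltn_trans (ltn_sum_pos ord0 _ p0); rewrite // p0.
apply: (CaDeviation alpha (p := p)) => // j.
by rewrite p0 ltn_sum_pos.
Qed.

(** The operations are defined from the loop structure, so homomorphisms commute
    with them. *)
Lemma ca_gens_morph (phi : {multiplicative L -> L}) i :
  (forall p, (p < i)%N -> F p `<=` phi @^-1` F p) ->
  ca_gens F i `<=` phi @^-1` ca_gens F i.
Proof.
have phi_dev n (alpha : admissible n) a :
    phi (deviation alpha a) = deviation alpha (phi \o a).
  elim: n alpha a => [|n IH] alpha a /=.
    by rewrite /loop_associator loop_morph_ldiv !loop_morphM.
  have E x : phi \o merge_at a (alpha ord_max) x =
             merge_at (phi \o a) (alpha ord_max) (phi x).
    by apply/funext => k; rewrite /merge_at /=; case: ifP.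
  by rewrite loop_morph_ldiv !loop_morphM !IH !E !loop_morphM.
move=> Fphi _ [p q a b hp hq le_i Fa Fb|p q r a b c hp hq hr le_i Fa Fb Fc
              |n alpha p a n0 hp le_i Fa] /=.
- rewrite /loop_commutator loop_morph_ldiv !loop_morphM.
  by apply: (CaCommutator hp hq); rewrite //; apply: Fphi => //;
    [case/andP: hp|case/andP: hq].
- rewrite /loop_associator loop_morph_ldiv !loop_morphM.
  by apply: (CaAssociator hp hq hr); rewrite //; apply: Fphi => //;
    [case/andP: hp|case/andP: hq|case/andP: hr].
- rewrite phi_dev; apply: (CaDeviation alpha (p := p)) => // j.
  by apply: Fphi; [case/andP: (hp j)|exact: Fa].
Qed.

Lemma ca_filtration_morph (phi : {multiplicative L -> L}) i :
  F i `<=` phi @^-1` F i.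
Proof.
elim/ltn_ind: i => -[|[|i]] IH; try by [].
rewrite {1}ca_filtrationE //.
apply: smallest_sub; first exact: normal_preimage nF.
by apply: subset_trans (ca_gens_morph IH) _ => x /=; exact: ca_filtration_gens.
Qed.

Lemma ca_filtration_auto (phi : {multiplicative L -> L}) i :
  bijective phi -> phi @` F i = F i.
Proof.
move=> [psi phiK psiK].
have psiM : {morph psi : a b / a * b}.
  by move=> a b; apply: (can_inj phiK); rewrite loop_morphM !psiK.
pose Psi := HB.pack_for {multiplicative L -> L} psi
  (isMultiplicative.Build _ _ psi psiM).
apply/seteqP; split=> [_ [x Fx <-]|x Fx]; first exact: ca_filtration_morph.
by exists (psi x) => //; exact: (ca_filtration_morph Psi).
Qed.

(** * Additivity of the commutator *)

Lemma coset_associative k p q r a b c :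
  (0 < p)%N -> (0 < q)%N -> (0 < r)%N -> (k <= p + q + r)%N ->
  F p a -> F q b -> F r c ->
  coset (F k) ((a * b) * c) = coset (F k) (a * (b * c)).
Proof.
move=> p0 q0 r0 le_k Fa Fb Fc; apply/esym/(coset_eqP _ _ nF).
by apply: (ca_filtration_anti le_k); exact: ca_associator_in.
Qed.

Lemma coset_commutative k p q a b :
  (0 < p)%N -> (0 < q)%N -> (k <= p + q)%N ->
  F p a -> F q b -> coset (F k) (a * b) = coset (F k) (b * a).
Proof.
move=> p0 q0 le_k Fa Fb; apply/esym/(coset_eqP _ _ nF).
by apply: (ca_filtration_anti le_k); exact: ca_commutator_in.
Qed.

(** A homomorphism with kernel [L_k] turns equations between cosets into plain
    equations, which can be rewritten. *)
Lemma ca_filtration_ker k : exists (M : loopType) (f : {multiplicative L -> M}),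
  forall x y, coset (F k) x = coset (F k) y <-> f x = f y.
Proof.
have [M [f FE]] := ca_filtration_normal k; exists M, f => x y.
rewrite FE !coset_kerE; split=> [E|-> //].
by have /= <- : [set z | f z = f y] x by rewrite -E.
Qed.

(** Rewriting rules modulo [L_(d+1)] for computing with commutators of total
    degree [d]: factors of total degree above [d] associate, and [L_d] is
    central. *)
Lemma ca_filtration_rules d : (0 < d)%N ->
  exists (M : loopType) (f : {multiplicative L -> M}),
  [/\ forall x y, coset (F d.+1) x = coset (F d.+1) y <-> f x = f y,
      forall p q r x y z, (0 < p)%N -> (0 < q)%N -> (0 < r)%N ->
        (d < p + q + r)%N -> F p x -> F q y -> F r z ->
        f x * f y * f z = f x * (f y * f z),
      forall x y w, F d w -> f x * f y * f w = f x * (f y * f w),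
      forall x y w, F d w -> f x * f w * f y = f x * f y * f w
    & forall x w, F d w -> f w * f x = f x * f w].
Proof.
move=> d0; have [M [f fE]] := ca_filtration_ker d.+1.
have A p q r x y z : (0 < p)%N -> (0 < q)%N -> (0 < r)%N ->
    (d < p + q + r)%N -> F p x -> F q y -> F r z ->
    f x * f y * f z = f x * (f y * f z).
  move=> *; rewrite -!loop_morphM; apply/fE.
  by apply: (@coset_associative _ p q r).
have C x w : F d w -> f w * f x = f x * f w.
  move=> Fw; rewrite -!loop_morphM; apply/fE.
  by apply: (@coset_commutative _ d 1); rewrite ?addn1.
have Ar x y w : F d w -> f x * f y * f w = f x * (f y * f w).
  by move=> Fw; apply: (A 1%N 1%N d).
exists M, f; split=> // x y w Fw.
by rewrite (A 1%N d 1%N) // ?add1n ?addn1 // (C y) // -Ar.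
Qed.

(** Modulo [L_(p+q+1)], with [u = [a, c]] and [w = [b, c]], one has
    [(ab)c = a(bc) = (a(cb))w = ((ac)b)w = (((ca)u)b)w = (c(ab))(uw)]. *)
Lemma ca_commutatorDl p q a b c : (0 < p)%N -> (0 < q)%N ->
  F p a -> F p b -> F q c ->
  coset (F (p + q).+1) (loop_commutator (a * b) c) =
  coset (F (p + q).+1) (loop_commutator a c * loop_commutator b c).
Proof.
move=> p0 q0 Fa Fb Fc.
have d0 : (0 < p + q)%N by rewrite addn_gt0 p0.
have [M [f [fE A Ar S _]]] := ca_filtration_rules d0.
have le_ppq : (p + q < p + p + q)%N.
  by rewrite -addnA -{1}[(p + q)%N]add0n ltn_add2r.
have Fu := ca_commutator_in p0 q0 Fa Fc; set u := loop_commutator a c in Fu *.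
have Fw := ca_commutator_in p0 q0 Fb Fc; set w := loop_commutator b c in Fw *.
apply/fE; rewrite /loop_commutator loop_morph_ldiv; apply/esym/ldivP.
rewrite !loop_morphM.
have Eac : f a * f c = f c * f a * f u by rewrite -!loop_morphM mulVKl.
have Ebc : f b * f c = f c * f b * f w by rewrite -!loop_morphM mulVKl.
have Aabc : f a * f b * f c = f a * (f b * f c) by apply: (A p p q).
have Aacb : f a * f c * f b = f a * (f c * f b).
  by apply: (A p q p); rewrite // addnAC.
have Acab : f c * f a * f b = f c * (f a * f b).
  by apply: (A q p p); rewrite // (addnC q) addnAC.
have -> : f a * f b * f c = f a * f c * f b * f w.
  by rewrite Aabc Ebc -(loop_morphM f c b) -Ar // loop_morphM Aacb.
rewrite Eac -(loop_morphM f c a) S // loop_morphM Acab.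
by have := Ar (c * (a * b)) u _ Fw; rewrite !loop_morphM => ->.
Qed.

(** Modulo [L_(p+q+1)], with [u = [a, b]] and [w = [a, c]], one has
    [a(bc) = (ab)c = ((ba)u)c = (b(ac))u = ((b(ca))w)u = ((bc)a)(uw)]. *)
Lemma ca_commutatorDr p q a b c : (0 < p)%N -> (0 < q)%N ->
  F p a -> F q b -> F q c ->
  coset (F (p + q).+1) (loop_commutator a (b * c)) =
  coset (F (p + q).+1) (loop_commutator a b * loop_commutator a c).
Proof.
move=> p0 q0 Fa Fb Fc.
have d0 : (0 < p + q)%N by rewrite addn_gt0 p0.
have [M [f [fE A Ar S C]]] := ca_filtration_rules d0.
have le_pqq : (p + q < p + q + q)%N by rewrite -{1}[(p + q)%N]addn0 ltn_add2l.
have Fu := ca_commutator_in p0 q0 Fa Fb; set u := loop_commutator a b in Fu *.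
have Fw := ca_commutator_in p0 q0 Fa Fc; set w := loop_commutator a c in Fw *.
apply/fE; rewrite /loop_commutator loop_morph_ldiv; apply/esym/ldivP.
rewrite !loop_morphM.
have Eab : f a * f b = f b * f a * f u by rewrite -!loop_morphM mulVKl.
have Eac : f a * f c = f c * f a * f w by rewrite -!loop_morphM mulVKl.
have Aabc : f a * f b * f c = f a * (f b * f c) by apply: (A p q q).
have Abac : f b * f a * f c = f b * (f a * f c).
  by apply: (A q p q); rewrite // (addnC q).
have Abca : f b * f c * f a = f b * (f c * f a).
  by apply: (A q q p); rewrite // addnAC (addnC q).
have -> : f a * (f b * f c) = f b * f a * f c * f u.
  by rewrite -Aabc Eab -(loop_morphM f b a) S // loop_morphM.
rewrite Abac Eac -(loop_morphM f c a) -Ar // loop_morphM -Abca (C w) //.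
by have := Ar (b * c * a) w _ Fu; rewrite !loop_morphM => ->.
Qed.

Lemma ca_commutator_congr p q a a' b b' : (0 < p)%N -> (0 < q)%N ->
  F p a -> F p a' -> F q b -> F q b' ->
  coset (F p.+1) a = coset (F p.+1) a' ->
  coset (F q.+1) b = coset (F q.+1) b' ->
  coset (F (p + q).+1) (loop_commutator a b) =
  coset (F (p + q).+1) (loop_commutator a' b').
Proof.
move=> p0 q0 Fa Fa' Fb Fb' /(coset_eqP _ _ nF) Fx /(coset_eqP _ _ nF) Fy.
rewrite -(mulVKl a a') (ca_commutatorDl p0 q0) //; last exact: ca_filtrationS.
rewrite coset_absorb //; first last.
- by have := ca_commutator_in (ltn0Sn p) q0 Fx Fb'; rewrite addSn.
- exact: nF.
rewrite -(mulVKl b b') (ca_commutatorDr p0 q0) //; last exact: ca_filtrationS.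
rewrite coset_absorb //; first exact: nF.
by have := ca_commutator_in p0 (ltn0Sn q) Fa Fy; rewrite addnS.
Qed.

(** * Multiadditive operations *)

Definition respects_degree m (D : ('I_m -> L) -> L) : Prop :=
  forall p a, (forall j, 0 < p j)%N -> (forall j, F (p j) (a j)) ->
  F (\sum_(j < m) p j)%N (D a).

Definition multiadditive m (D : ('I_m -> L) -> L) : Prop :=
  forall p a j u v, (forall k, 0 < p k)%N -> (forall k, F (p k) (a k)) ->
  F (p j) u -> F (p j) v ->
  coset (F (\sum_(k < m) p k).+1) (D (replace_at a j (u * v))) =
  coset (F (\sum_(k < m) p k).+1)
        (D (replace_at a j u) * D (replace_at a j v)).

(** The entries are exchanged one at a time.  Writing [b_j = a_j z] with [z] in
    the term of index [p_j + 1], additivity makes the change a factor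
    [D (.. z ..)], which lies in the term of index [p + 1]. *)
Lemma multiadditive_congr m (D : ('I_m -> L) -> L) p a b :
  respects_degree D -> multiadditive D ->
  (forall j, 0 < p j)%N -> (forall j, F (p j) (a j)) ->
  (forall j, F (p j) (b j)) ->
  (forall j, coset (F (p j).+1) (a j) = coset (F (p j).+1) (b j)) ->
  coset (F (\sum_(j < m) p j).+1) (D a) = coset (F (\sum_(j < m) p j).+1) (D b).
Proof.
move=> Ddeg Dadd p0 Fa Fb ab.
pose mix i (k : 'I_m) := if (k < i)%N then b k else a k.
have Fmix i k : F (p k) (mix i k) by rewrite /mix; case: ifP.
suff mixE i : (i <= m)%N -> coset (F (\sum_(j < m) p j).+1) (D a) =
                            coset (F (\sum_(j < m) p j).+1) (D (mix i)).
  by rewrite (mixE m) //; congr (coset _ (D _)); apply/funext => k;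
     rewrite /mix ltn_ord.
elim: i => [|i IH] im; first by congr (coset _ (D _)); apply/funext.
rewrite IH 1?ltnW //; pose j := Ordinal im.
have -> : mix i = replace_at (mix i) j (a j).
  by rewrite -{1}(replace_at_id (mix i) j) {2}/mix ltnn.
have -> : mix i.+1 = replace_at (mix i) j (b j).
  apply/funext => k; rewrite /replace_at /mix ltnS leq_eqVlt -val_eqE /=.
  by case: eqP => //= ki; congr b; exact: val_inj.
have Fz : F (p j).+1 (ldiv (a j) (b j)) by exact/(coset_eqP _ _ nF).
have := Dadd _ _ _ _ _ p0 (Fmix i) (Fa j) (ca_filtrationS Fz).
rewrite mulVKl => ->; rewrite coset_absorb //; first exact: nF.
rewrite -(sum_replace_atS p j); apply: Ddeg.
  by move=> k; rewrite /replace_at; case: ifP.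
exact: (replace_at_all (P := fun i x => F i x)).
Qed.

(** * Deviations *)

Fact extend_admissible_subproof n (alpha : admissible n) (j : 'I_n.+3)
  (k : 'I_n.+1) : (oapp (fun i => alpha i : nat) j (insub (val k)) < k.+3)%N.
Proof.
case: insubP => [i _ /= <-|]; first exact: ltn_ord.
by rewrite -leqNgt /= => nk; apply: leq_trans (ltn_ord j) _.
Qed.

(** The sequence [alpha] followed by [j].  The codomain of an admissible
    sequence depends on the index, so the entries are first looked up as plain
    numbers. *)
Definition extend_admissible n (alpha : admissible n) (j : 'I_n.+3) :
  admissible n.+1 := fun k => Ordinal (extend_admissible_subproof alpha j k).

Lemma extend_admissibleK n (alpha : admissible n) j :
  admissible_belast (extend_admissible alpha j) = alpha.
Proof.
apply: functional_extensionality_dep => k; apply: val_inj => /=.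
case: insubP => [i _ /= ik|]; last by rewrite /= ltn_ord.
by have -> : i = k by exact: val_inj.
Qed.

Lemma extend_admissible_last n (alpha : admissible n) j :
  extend_admissible alpha j ord_max = j.
Proof. by apply: val_inj => /=; rewrite insubF ?ltnn. Qed.

(** The tuple [a] with its [j]-th entry replaced by the two entries [u] and [v]:
    [v] is inserted at position [j + 1], the one position that [unlift] leaves
    out.  Merging positions [j] and [j + 1] undoes the splitting. *)
Definition split_at (T : Type) m (a : 'I_m -> T) (j : 'I_m) (u v : T)
    (i : 'I_m.+1) : T :=
  oapp (replace_at a j u) v (unlift (lift ord0 j) i).

Lemma lift_lift0 m (j : 'I_m) :
  lift (lift ord0 j) j = widen_ord (leqnSn m) j.
Proof. by apply: val_inj; rewrite /= /bump /= add1n ltnn. Qed.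

Lemma deviation_split n (alpha : admissible n) (a : 'I_n.+3 -> L) j u v :
  let D x := deviation alpha (replace_at a j x) in
  deviation (extend_admissible alpha j) (split_at a j u v) =
  ldiv (D u * D v) (D (u * v)).
Proof.
have mergeE x : merge_at (split_at a j u v) j x = replace_at a j x.
  apply/funext => k; rewrite /merge_at /replace_at /split_at.
  case kj: (k == j) => //; by rewrite liftK /= /replace_at kj.
have su : split_at a j u v (widen_ord (leqnSn _) j) = u.
  by rewrite -lift_lift0 /split_at liftK /= /replace_at eqxx.
have sv : split_at a j u v (lift ord0 j) = v.
  by rewrite /split_at unlift_none.
by rewrite /= extend_admissibleK extend_admissible_last !mergeE su sv.
Qed.

(** The defect of additivity in the [j]-th argument is a deviation of level
    [n + 1] whose total degree exceeds that of the deviation by [p_j]. *)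
Lemma deviation_multiadditive n (alpha : admissible n) :
  multiadditive (deviation (L := L) alpha).
Proof.
move=> p a j u v p0 Fa Fu Fv; apply/esym/(coset_eqP _ _ nF).
rewrite -deviation_split.
pose q := split_at p j (p j) (p j).
have q0 i : (0 < q i)%N.
  by rewrite /q /split_at; case: unlift => //= k; rewrite replace_at_id.
have qE : (\sum_(i < n.+4) q i = p j + \sum_(k < n.+3) p k)%N.
  rewrite (bigD1_ord (lift ord0 j)) //= {1}/q /split_at unlift_none /=.
  congr (_ + _)%N; apply: eq_bigr => k _.
  by rewrite /q /split_at liftK /= replace_at_id.
apply: (@ca_filtration_anti _ (\sum_(i < n.+4) q i)).
  by rewrite qE -add1n leq_add2r.
apply: ca_deviation_in => // i; rewrite /q /split_at.
case: unlift => //= k; exact: (replace_at_all (P := fun i x => F i x)).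
Qed.

(** * The associator as the deviation of level 0 *)

Definition tuple3 (T : Type) (a b c : T) : 'I_3 -> T := tnth [tuple a; b; c].

Lemma tuple3_all (T : Type) (P : nat -> T -> Prop) p q r a b c :
  P p a -> P q b -> P r c -> forall k, P (tuple3 p q r k) (tuple3 a b c k).
Proof. by move=> Pa Pb Pc [[|[|[|k]]] kP]. Qed.

Lemma sum_tuple3 p q r : (\sum_(k < 3) tuple3 p q r k = p + q + r)%N.
Proof. by rewrite !big_ord_recl big_ord0 addn0 addnA. Qed.

Lemma replace_tuple3 (T : Type) (a b c x : T) :
  ((replace_at (tuple3 a b c) ord0 x = tuple3 x b c) *
   (replace_at (tuple3 a b c) (lift ord0 ord0) x = tuple3 a x c) *
   (replace_at (tuple3 a b c) ord_max x = tuple3 a b x))%type.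
Proof. by do !split; apply/funext => -[[|[|[|k]]] kP]. Qed.

Definition admissible0 : admissible 0 := fun=> ord0.

Lemma deviation0 (a b c : L) :
  deviation admissible0 (tuple3 a b c) = loop_associator a b c.
Proof. by rewrite /= /tuple3 !(tnth_nth 1) /= !inordK. Qed.

Section Associator.
Variables p q r : nat.
Hypotheses (p0 : (0 < p)%N) (q0 : (0 < q)%N) (r0 : (0 < r)%N).

Let pos k : (0 < tuple3 p q r k)%N.
Proof. by case: k => [[|[|[|k]]] kP]. Qed.

Lemma ca_associator_congr a a' b b' c c' :
  F p a -> F p a' -> F q b -> F q b' -> F r c -> F r c' ->
  coset (F p.+1) a = coset (F p.+1) a' ->
  coset (F q.+1) b = coset (F q.+1) b' ->
  coset (F r.+1) c = coset (F r.+1) c' ->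
  coset (F (p + q + r).+1) (loop_associator a b c) =
  coset (F (p + q + r).+1) (loop_associator a' b' c').
Proof.
move=> Fa Fa' Fb Fb' Fc Fc' ea eb ec; rewrite -!deviation0 -sum_tuple3.
apply: multiadditive_congr => //.
- by move=> *; exact: ca_deviation_in.
- exact: deviation_multiadditive.
- exact: (tuple3_all (P := fun i x => F i x)).
- exact: (tuple3_all (P := fun i x => F i x)).
- by case=> [[|[|[|k]]] kP].
Qed.

Lemma ca_associatorD a b c : F p a -> F q b -> F r c ->
  [/\ forall a', F p a' ->
        coset (F (p + q + r).+1) (loop_associator (a * a') b c) =
        coset (F (p + q + r).+1)
              (loop_associator a b c * loop_associator a' b c),
      forall b', F q b' ->
        coset (F (p + q + r).+1) (loop_associator a (b * b') c) =
        coset (F (p + q + r).+1)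
              (loop_associator a b c * loop_associator a b' c)
    & forall c', F r c' ->
        coset (F (p + q + r).+1) (loop_associator a b (c * c')) =
        coset (F (p + q + r).+1)
              (loop_associator a b c * loop_associator a b c')].
Proof.
move=> Fa Fb Fc; have Fabc := tuple3_all (P := fun i x => F i x) Fa Fb Fc.
have add j u v :=
  deviation_multiadditive admissible0 (j := j) (u := u) (v := v) pos Fabc.
split=> [x|x|x] Fx; rewrite -!deviation0 -sum_tuple3.
- by have := add ord0 a x Fa Fx; rewrite !replace_tuple3.
- by have := add (lift ord0 ord0) b x Fb Fx; rewrite !replace_tuple3.
- by have := add ord_max c x Fc Fx; rewrite !replace_tuple3.
Qed.

End Associator.

End Filtration.

(** * Assembling the graded operations *)

Section Assembly.
Variables (L : loopType) (nL : forall i, normal_subloop (ca_filtration L i)).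
Local Notation F := (ca_filtration L).
Local Notation gr := (ca_gr nL).

Fact ca_rep_subproof i (u : gr i) :
  exists a, F i a /\ sval u = coset (F i.+1) a.
Proof. by have [a Fa uE] := svalP u; exists a. Qed.

(** The induced maps are defined on a chosen representative of each class; the
    congruence lemmas make the choice immaterial. *)
Definition ca_rep i (u : gr i) : L := sval (cid (ca_rep_subproof u)).

Lemma ca_rep_in i (u : gr i) : F i (ca_rep u).
Proof. by rewrite /ca_rep; case: cid => a []. Qed.

Lemma ca_repE i (u : gr i) : sval u = coset (F i.+1) (ca_rep u).
Proof. by rewrite /ca_rep; case: cid => a []. Qed.

Lemma ca_rep_class i a (Fa : F i a) :
  coset (F i.+1) (ca_rep (ca_class nL Fa)) = coset (F i.+1) a.
Proof. by rewrite -ca_repE. Qed.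

Lemma ca_repM i (u v : gr i) :
  coset (F i.+1) (ca_rep (u * v)) = coset (F i.+1) (ca_rep u * ca_rep v).
Proof. by rewrite -ca_repE /= !ca_repE coset_mul. Qed.

Lemma ca_rep_mul_in i (u v : gr i) : F i (ca_rep u * ca_rep v).
Proof.
by have [_ FM _ _] := normal_subloopW (nL i); apply: FM; exact: ca_rep_in.
Qed.

Lemma ca_class_eq i a b (Fa : F i a) (Fb : F i b) :
  coset (F i.+1) a = coset (F i.+1) b -> ca_class nL Fa = ca_class nL Fb.
Proof. by move=> ab; apply: quot_eq. Qed.

Lemma ca_class_eqM i a b c (Fa : F i a) (Fb : F i b) (Fc : F i c) :
  coset (F i.+1) c = coset (F i.+1) (a * b) ->
  ca_class nL Fc = ca_class nL Fa * ca_class nL Fb.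
Proof. by move=> cab; apply: quot_eq; rewrite /= coset_mul. Qed.

Lemma ca_gr_abelian i : (0 < i)%N -> abelian_group (gr i).
Proof.
move=> i0; have lt_i2 : (i < i + i)%N by rewrite -{1}[i]addn0 ltn_add2l.
split=> [u v w|u v]; apply: quot_eq; rewrite /= !ca_repE !coset_mul //.
  apply/esym/(@coset_associative _ _ i i i) => //; try exact: ca_rep_in.
  by rewrite (leq_trans lt_i2) ?leq_addr.
by apply: (@coset_commutative _ _ i i) => //; exact: ca_rep_in.
Qed.

Lemma ca_gr_commutator p q : (0 < p)%N -> (0 < q)%N ->
  exists f : gr p -> gr q -> gr (p + q),
    [/\ forall (a b : L) (ha : F p a) (hb : F q b),
          exists h : F (p + q) (loop_commutator a b),
            f (ca_class nL ha) (ca_class nL hb) = ca_class nL h,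
        forall v, {morph f^~ v : u u' / u * u'}
      & forall u, {morph f u : v v' / v * v'}].
Proof.
move=> p0 q0.
exists (fun u v => ca_class nL
  (ca_commutator_in p0 q0 (ca_rep_in u) (ca_rep_in v))).
split=> [a b ha hb|v u u'|u v v'].
- exists (ca_commutator_in p0 q0 ha hb); apply: ca_class_eq.
  by apply: ca_commutator_congr; rewrite ?ca_rep_class //; exact: ca_rep_in.
- apply: ca_class_eqM; rewrite -ca_commutatorDl //; try exact: ca_rep_in.
  by apply: ca_commutator_congr; rewrite ?ca_repM //;
    (exact: ca_rep_in || exact: ca_rep_mul_in).
- apply: ca_class_eqM; rewrite -ca_commutatorDr //; try exact: ca_rep_in.
  by apply: ca_commutator_congr; rewrite ?ca_repM //;
    (exact: ca_rep_in || exact: ca_rep_mul_in).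
Qed.

Lemma ca_gr_associator p q r : (0 < p)%N -> (0 < q)%N -> (0 < r)%N ->
  exists f : gr p -> gr q -> gr r -> gr (p + q + r),
    [/\ forall (a b c : L) (ha : F p a) (hb : F q b) (hc : F r c),
          exists h : F (p + q + r) (loop_associator a b c),
            f (ca_class nL ha) (ca_class nL hb) (ca_class nL hc) =
            ca_class nL h,
        forall v w, {morph (fun u => f u v w) : u u' / u * u'},
        forall u w, {morph (fun v => f u v w) : v v' / v * v'}
      & forall u v, {morph f u v : w w' / w * w'}].
Proof.
move=> p0 q0 r0.
exists (fun u v w => ca_class nL
  (ca_associator_in p0 q0 r0 (ca_rep_in u) (ca_rep_in v) (ca_rep_in w))).
have add (u : gr p) (v : gr q) (w : gr r) :=
  ca_associatorD p0 q0 r0 (ca_rep_in u) (ca_rep_in v) (ca_rep_in w).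
split=> [a b c ha hb hc|v w u u'|u w v v'|u v w w'].
- exists (ca_associator_in p0 q0 r0 ha hb hc); apply: ca_class_eq.
  by apply: ca_associator_congr; rewrite ?ca_rep_class //; exact: ca_rep_in.
- apply: ca_class_eqM; have [E _ _] := add u v w.
  rewrite -E; last exact: ca_rep_in.
  by apply: ca_associator_congr; rewrite ?ca_repM //;
    (exact: ca_rep_in || exact: ca_rep_mul_in).
- apply: ca_class_eqM; have [_ E _] := add u v w.
  rewrite -E; last exact: ca_rep_in.
  by apply: ca_associator_congr; rewrite ?ca_repM //;
    (exact: ca_rep_in || exact: ca_rep_mul_in).
- apply: ca_class_eqM; have [_ _ E] := add u v w.
  rewrite -E; last exact: ca_rep_in.
  by apply: ca_associator_congr; rewrite ?ca_repM //;
    (exact: ca_rep_in || exact: ca_rep_mul_in).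
Qed.

Lemma ca_gr_multiadditive m (D : ('I_m -> L) -> L) (p : 'I_m -> nat) :
  respects_degree D -> multiadditive D -> (forall j, 0 < p j)%N ->
  exists f : (forall j, gr (p j)) -> gr (\sum_(j < m) p j)%N,
    (forall (a : 'I_m -> L) (ha : forall j, F (p j) (a j)),
       exists h : F (\sum_(j < m) p j)%N (D a),
         f (fun j => ca_class nL (ha j)) = ca_class nL h) /\
    (forall (x : forall j, gr (p j)) (j : 'I_m),
       {morph (fun u : gr (p j) => f (dfwith x u)) : u u' / u * u'}).
Proof.
move=> Ddeg Dadd p0.
exists (fun x => ca_class nL (Ddeg p _ p0 (fun j => ca_rep_in (x j)))).
split=> [a ha|x j u u'].
  exists (Ddeg p a p0 ha); apply: ca_class_eq.
  by apply: multiadditive_congr => // j; rewrite ?ca_rep_class //;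
    exact: ca_rep_in.
have repE (w : gr (p j)) : (fun k => ca_rep (dfwith x w k)) =
              replace_at (fun k => ca_rep (x k)) j (ca_rep w).
  apply/funext => k; rewrite /replace_at; case: eqVneq => [->|kj].
    by rewrite dfwith_in.
  by rewrite dfwith_out // eq_sym.
apply: ca_class_eqM; rewrite !repE -Dadd //; try by move=> *; exact: ca_rep_in.
have Frep w : F (p j) w ->
    forall k, F (p k) (replace_at (fun k => ca_rep (x k)) j w k).
  by apply: (replace_at_all_in (P := fun i x => F i x)) => k; exact: ca_rep_in.
apply: multiadditive_congr => //.
- by apply: Frep; exact: ca_rep_in.
- by apply: Frep; exact: ca_rep_mul_in.
- by move=> k; rewrite /replace_at; case: eqP => // ->; exact: ca_repM.
Qed.

End Assembly.

Theorem mainTheorem1 (L : loopType) :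
  (* (1), first half: every L_i is a normal subloop *)
  exists nL : forall i : nat, normal_subloop (ca_filtration L i),
  [/\
   (* (1), second half *)
   forall (i : nat) (phi : {multiplicative L -> L}), (0 < i)%N ->
     bijective phi -> phi @` ca_filtration L i = ca_filtration L i,
   (* (2) *)
   forall i : nat, (0 < i)%N ->
     ca_filtration L i.+1 `<=` ca_filtration L i /\
     abelian_group (ca_gr nL i)
   & (* (3) *)
   [/\
    forall p q : nat, (0 < p)%N -> (0 < q)%N ->
      exists f : ca_gr nL p -> ca_gr nL q -> ca_gr nL (p + q),
        [/\ forall (a b : L) (ha : ca_filtration L p a)
                (hb : ca_filtration L q b),
              exists h : ca_filtration L (p + q) (loop_commutator a b),
                f (ca_class nL ha) (ca_class nL hb) = ca_class nL h,
            forall v, {morph f^~ v : u u' / u * u'}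
          & forall u, {morph f u : v v' / v * v'}],
    forall p q r : nat, (0 < p)%N -> (0 < q)%N -> (0 < r)%N ->
      exists f : ca_gr nL p -> ca_gr nL q -> ca_gr nL r ->
                 ca_gr nL (p + q + r),
        [/\ forall (a b c : L) (ha : ca_filtration L p a)
                (hb : ca_filtration L q b) (hc : ca_filtration L r c),
              exists h : ca_filtration L (p + q + r) (loop_associator a b c),
                f (ca_class nL ha) (ca_class nL hb) (ca_class nL hc) =
                ca_class nL h,
            forall v w, {morph (fun u => f u v w) : u u' / u * u'},
            forall u w, {morph (fun v => f u v w) : v v' / v * v'}
          & forall u v, {morph f u v : w w' / w * w'}]
    & forall (n : nat) (alpha : admissible n) (p : 'I_n.+3 -> nat),
      (0 < n)%N -> (forall j, (0 < p j)%N) ->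
      exists f : (forall j : 'I_n.+3, ca_gr nL (p j)) ->
                 ca_gr nL (\sum_(j < n.+3) p j)%N,
        (forall (a : 'I_n.+3 -> L) (ha : forall j, ca_filtration L (p j) (a j)),
           exists h : ca_filtration L (\sum_(j < n.+3) p j)%N
                        (deviation alpha a),
             f (fun j => ca_class nL (ha j)) = ca_class nL h) /\
        (forall (x : forall j : 'I_n.+3, ca_gr nL (p j)) (j : 'I_n.+3),
           {morph (fun u : ca_gr nL (p j) => f (dfwith x u)) :
              u u' / u * u'})]].
Proof.
exists (@ca_filtration_normal L); split.
- by move=> i phi _; exact: ca_filtration_auto.
- by move=> i i0; split; [exact: ca_filtrationS|exact: ca_gr_abelian].
split.
- exact: ca_gr_commutator.
- exact: ca_gr_associator.
- move=> n alpha p _ p0; apply: ca_gr_multiadditive => //.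
    by move=> q a; exact: ca_deviation_in.
  exact: deviation_multiadditive.
Qed.
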